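(* Let $A$ be a $B_\infty$ algebra, with structure given by a multiplication $\bullet$ and a differential $\partial$ on the tensor coalgebra $V=T^c(A)$. Consider the 2-associative differential algebra $(V,\bullet,\odot,\partial)$ with unit $1_{\mathbb K}$, where $\odot$ is concatenation of tensors, and the underlying $B_\infty$ structure $(\mu_{\bullet}^{\odot},d_{\partial}^{\odot})$ on the graded vector space $V$. Then the inclusion map $\iota_1\colon A=A^{\otimes1}\to V=T^c(A)$ is a homomorphism of $B_\infty$ algebras from $A$ (with its given $B_\infty$ structure) to $V$ (with its underlying $B_\infty$ structure).
   Context: Conventions. Vector spaces are $\mathbb Z$-graded over a field $\mathbb K$; maps have degree $0$ unless stated otherwise; the Koszul sign rule is used: $(f\otimes g)(a\otimes b)=(-1)^{|g||a|}f(a)\otimes g(b)$ and the symmetry is $a\otimes b\mapsto(-1)^{|a||b|}b\otimes a$. Tensor coalgebra. For a graded vector space $X$, $T^c(X)=\bigoplus_{k\ge0}X^{\otimes k}$ is the coalgebra with deconcatenation $\Delta(x_1\cdots x_k)=\sum_{i=0}^k x_1\cdots x_i\otimes x_{i+1}\cdots x_k$, counit $\varepsilon$ the projection to $X^{\otimes0}=\mathbb K$, and unit $1=1_{\mathbb K}$. Write $\overline T^c(X)=\bigoplus_{k\ge1}X^{\otimes k}$ and $p_1\colon T^c(X)\to X$ for the projection. $T^c(X)\otimes T^c(X)$ carries the usual tensor product coalgebra structure. $B_\infty$ algebra (in the shifted convention). A $B_\infty$ structure on $X$ is a pair $(\mu,d)$ where $\mu\colon T^c(X)\otimes T^c(X)\to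 T^c(X)$ is a coalgebra map of degree $0$ that is associative with unit $1$, and $d\colon T^c(X)\to T^c(X)$ is a coderivation ($\Delta d=(d\otimes\mathrm{id}+\mathrm{id}\otimes d)\Delta$) of degree $-1$ with $d(1)=0$, $d^2=0$ and $d\mu=\mu(d\otimes\mathrm{id}+\mathrm{id}\otimes d)$. Its structure maps are $m_n=p_1d|_{X^{\otimes n}}\colon X^{\otimes n}\to X$ ($n\ge1$) and $m_{i,j}=p_1\mu|_{X^{\otimes i}\otimes X^{\otimes j}}\colon X^{\otimes i}\otimes X^{\otimes j}\to X$ ($i,j\ge1$); these determine $(\mu,d)$. A homomorphism of $B_\infty$ algebras $f\colon X\to Y$ is a linear map of degree $0$ commuting with all structure maps: $f m_n=m_n f^{\otimes n}$ and $f m_{i,j}=m_{i,j}(f^{\otimes i}\otimes f^{\otimes j})$. 2-associative differential algebra. This is a (unital associative) differential graded algebra $(V,\bullet,1,\partial)$, with $\partial$ of degree $-1$, together with a second associative operation $\odot$ with the same unit $1$ and no further compatibility. Underlying $B_\infty$ structure. For a 2-associative differential algebra $(V,\bullet,\odot,1,\partial)$, let $\tau_1^{\odot}\colon\overline T^c(V)\to V$ be given on $V^{\otimes n}$ by the iterated multiplication $v_1\otimes\cdots\otimes v_n\mapsto v_1\odot\cdots\odot v_n$. The underlying $B_\infty$ structure $(\mu_\bullet^\odot,d_\partial^\odot)$ on $V$ is the unique $B_\infty$ structure on $V$ with $\tau_1^\odot\mu_\bullet^\odot=\bullet(\tau_1^\odot\otimes\tau_1^\odot)$ on $\overline T^c(V)\otimes\overline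 T^c(V)$ and $\tau_1^\odot d_\partial^\odot=\partial\tau_1^\odot$ on $\overline T^c(V)$. (Here it is applied to the graded vector space $V=T^c(A)$, so it lives on $T^c(T^c(A))$.) *)

(* Defs.v *)
From HB Require Import structures.
From mathcomp Require Import all_boot all_order all_algebra.
From mathcomp Require Import generic_quotient boolp.

Set Implicit Arguments.
Unset Strict Implicit.
Unset Printing Implicit Defensive.

Import GRing.Theory.
Local Open Scope ring_scope.

Section Presented.
Variables (K : fieldType) (T : choiceType).
Variable P : forall W : lmodType K, (T -> W) -> Prop.

Definition peval (W : lmodType K) (f : T -> W) (s : seq (K * T)) : W :=
  \sum_(p <- s) p.1 *: f p.2.

(* Two formal linear combinations of elements of T are identified when every
   map T -> W satisfying P sends them to the same element of W.  For P the
   property of being bilinear (resp. multilinear), this is the usual quotient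
   of the free vector space on T by the (multi)linearity relations, with its
   universal property built in. *)
Definition peqv (s t : seq (K * T)) : bool :=
  `[< forall (W : lmodType K) (f : T -> W), P f -> peval f s = peval f t >].

Lemma peqv_refl : reflexive peqv.
Proof. by move=> s; apply/asboolP. Qed.

Lemma peqv_sym : symmetric peqv.
Proof. by move=> s t; apply/asboolP/asboolP => h W f Pf; rewrite h. Qed.

Lemma peqv_trans : transitive peqv.
Proof.
by move=> s t u /asboolP h /asboolP k; apply/asboolP => W f Pf; rewrite h // k.
Qed.

Canonical peqv_equiv := EquivRel peqv peqv_refl peqv_sym peqv_trans.

Definition pres : Type := {eq_quot peqv}%qT.
HB.instance Definition _ := Choice.on pres.

Definition pclass (s : seq (K * T)) : pres := (\pi_({eq_quot peqv}) s)%qT.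
Definition prepr (x : pres) : seq (K * T) := repr (x : {eq_quot peqv}%qT).

Definition pgen (t : T) : pres := pclass [:: (1, t)].

(* The extension of f to formal combinations; meaningful (independent of the
   representative, linear) when f satisfies P, see plift_class below. *)
Definition plift (W : lmodType K) (f : T -> W) (x : pres) : W :=
  locked (peval f (prepr x)).

Lemma plift_class (W : lmodType K) (f : T -> W) s :
  P f -> plift f (pclass s) = peval f s.
Proof.
move=> Pf; rewrite /plift -lock /prepr /pclass.
have /eqmodP/asboolP h : (repr (\pi_({eq_quot peqv}) s) = s %[mod {eq_quot peqv}])%qT.
  by rewrite reprK.
exact: h.
Qed.

Lemma pres_ext (x y : pres) :
  (forall (W : lmodType K) (f : T -> W), P f -> plift f x = plift f y) -> x = y.
Proof.
move=> h.
rewrite -[x](@reprK _ {eq_quot peqv}%qT) -[y](@reprK _ {eq_quot peqv}%qT).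
apply/eqmodP/asboolP => W f Pf.
by have := h W f Pf; rewrite /plift -!lock.
Qed.

Definition pzero := pclass [::].
Definition padd (x y : pres) := pclass (prepr x ++ prepr y).
Definition pscale (a : K) (x : pres) :=
  pclass [seq (a * p.1, p.2) | p <- prepr x].
Definition popp (x : pres) := pscale (-1) x.

Lemma plift_zero (W : lmodType K) (f : T -> W) : P f -> plift f pzero = 0.
Proof. by move=> Pf; rewrite plift_class // /peval big_nil. Qed.
Lemma plift_add (W : lmodType K) (f : T -> W) x y : P f ->
  plift f (padd x y) = plift f x + plift f y.
Proof. by move=> Pf; rewrite plift_class // /plift -!lock /peval big_cat. Qed.
Lemma plift_scale (W : lmodType K) (f : T -> W) a x : P f ->
  plift f (pscale a x) = a *: plift f x.
Proof.
move=> Pf; rewrite plift_class // /plift -lock /peval big_map scaler_sumr.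
by apply: eq_bigr => p _; rewrite scalerA.
Qed.
Lemma plift_opp (W : lmodType K) (f : T -> W) x : P f ->
  plift f (popp x) = - plift f x.
Proof. by move=> Pf; rewrite plift_scale // scaleN1r. Qed.

Lemma paddA : associative padd.
Proof. by move=> x y z; apply: pres_ext => W f Pf; rewrite !plift_add // addrA. Qed.
Lemma paddC : commutative padd.
Proof. by move=> x y; apply: pres_ext => W f Pf; rewrite !plift_add // addrC. Qed.
Lemma padd0 : left_id pzero padd.
Proof.
by move=> x; apply: pres_ext => W f Pf; rewrite plift_add // plift_zero // add0r.
Qed.
Lemma paddN : left_inverse pzero popp padd.
Proof.
move=> x; apply: pres_ext => W f Pf.
by rewrite plift_add // plift_opp // plift_zero // addNr.
Qed.
HB.instance Definition _ := GRing.isZmodule.Build pres paddA paddC padd0 paddN.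

Lemma pscaleA a b x : pscale a (pscale b x) = pscale (a * b) x.
Proof. by apply: pres_ext => W f Pf; rewrite !plift_scale // scalerA. Qed.
Lemma pscale1 : left_id 1 pscale.
Proof. by move=> x; apply: pres_ext => W f Pf; rewrite plift_scale // scale1r. Qed.
Lemma pscaleDr : right_distributive pscale +%R.
Proof.
move=> a x y; apply: pres_ext => W f Pf.
by rewrite !(plift_add, plift_scale) // scalerDr.
Qed.
Lemma pscaleDl x : {morph pscale^~ x : a b / a + b}.
Proof.
move=> a b; apply: pres_ext => W f Pf.
by rewrite !(plift_add, plift_scale) // scalerDl.
Qed.
HB.instance Definition _ :=
  GRing.Zmodule_isLmodule.Build K pres pscaleA pscale1 pscaleDr pscaleDl.

Lemma plift_linear (W : lmodType K) (f : T -> W) : P f -> linear (plift f).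
Proof.
move=> Pf a x y.
by rewrite [_ + _]/(padd (pscale a x) y) plift_add // plift_scale.
Qed.

Lemma plift_gen (W : lmodType K) (f : T -> W) t : P f -> plift f (pgen t) = f t.
Proof. by move=> Pf; rewrite plift_class // /peval big_seq1 scale1r. Qed.

Lemma plift_sum (W : lmodType K) (f : T -> W) (I : Type) (r : seq I)
    (F : I -> pres) : P f ->
  plift f (\sum_(i <- r) F i) = \sum_(i <- r) plift f (F i).
Proof.
move=> Pf; elim: r => [|i r IH]; first by rewrite !big_nil plift_zero.
by rewrite !big_cons [_ + _]/(padd _ _) plift_add // IH.
Qed.

Lemma plift_comb (W : lmodType K) (f g h : T -> W) c x :
  (forall t, h t = c *: f t + g t) -> plift h x = c *: plift f x + plift g x.
Proof.
move=> e; rewrite /plift -!lock /peval scaler_sumr -big_split.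
by apply: eq_bigr => p _; rewrite e /= scalerDr !scalerA mulrC.
Qed.

Lemma pres_spanned (x : pres) :
  exists s : seq (K * T), x = \sum_(p <- s) p.1 *: pgen p.2.
Proof.
exists (prepr x); apply: pres_ext => W f Pf.
rewrite plift_sum // [LHS]/plift -lock; apply: eq_bigr => p _.
by rewrite [_ *: pgen _]/(pscale _ _) plift_scale // plift_gen.
Qed.

End Presented.

(* A Z-grading, given by its projections onto the homogeneous components:
   V_n is the image of gproj n, i.e. the set of fixed points of gproj n. *)
HB.mixin Record isGraded (K : fieldType) V of GRing.Lmodule K V := {
  gproj : int -> V -> V;
  gproj_is_linear : forall n, linear (gproj n);
  gproj_proj : forall m n x,
    gproj m (gproj n x) = if m == n then gproj n x else 0;
  gproj_sum : forall x,
    exists s : seq int, uniq s && (x == \sum_(n <- s) gproj n x)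
}.

#[short(type="gradedVectType")]
HB.structure Definition GradedVect (K : fieldType) :=
  {V of isGraded K V & GRing.Lmodule K V}.

Section ByDegree.
Variables (K : fieldType) (X : gradedVectType K).

HB.instance Definition _ n :=
  GRing.isLinear.Build K X X *:%R (@gproj K X n) (@gproj_is_linear K X n).

Definition homog (n : int) (x : X) : Prop := gproj n x = x.

Definition gsupp (x : X) : seq int := xchoose (gproj_sum x).

Lemma gsupp_uniq x : uniq (gsupp x).
Proof. by have /andP[] := xchooseP (gproj_sum x). Qed.

Lemma gsupp_sum x : x = \sum_(n <- gsupp x) gproj n x.
Proof. by have /andP[_ /eqP] := xchooseP (gproj_sum x). Qed.

Lemma gproj_notin x n : n \notin gsupp x -> gproj n x = 0.
Proof.
move=> nx; rewrite {1}(gsupp_sum x) linear_sum big_seq big1 //= => m mx.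
by rewrite gproj_proj; case: eqP nx => // ->; rewrite mx.
Qed.

Lemma homog0 n : homog n 0.
Proof. exact: linear0. Qed.

Lemma homog_gproj n x : homog n (gproj n x).
Proof. by rewrite /homog gproj_proj eqxx. Qed.

Lemma homog_proj m n x : homog n x -> gproj m x = if m == n then x else 0.
Proof. by move=> hx; rewrite -{1}hx gproj_proj hx. Qed.

Variable W : lmodType K.

(* The map which is F n on the homogeneous elements of degree n. *)
Definition by_degree (F : int -> X -> W) (x : X) : W :=
  \sum_(n <- gsupp x) F n (gproj n x).

Lemma by_degree_widen F (s : seq int) x : (forall n, F n 0 = 0) -> uniq s ->
  {subset gsupp x <= s} -> by_degree F x = \sum_(n <- s) F n (gproj n x).
Proof.
move=> F0 us sub; rewrite /by_degree.
rewrite [RHS](bigID (mem (gsupp x))) /= [X in _ + X]big1 ?addr0; last first.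
  by move=> n /gproj_notin ->; rewrite F0.
rewrite -[RHS]big_filter; apply: perm_big.
apply: uniq_perm; rewrite ?gsupp_uniq ?filter_uniq // => n.
by rewrite mem_filter; apply/idP/andP => [h|[]//]; split=> //; exact: sub.
Qed.

Lemma by_degree_linear F : (forall n, linear (F n)) -> linear (by_degree F).
Proof.
move=> lF a x y.
have F0 n : F n 0 = 0.
  by have := lF n (-1) 0 0; rewrite scaler0 addr0 scaleN1r addNr.
pose s := undup (gsupp x ++ gsupp y ++ gsupp (a *: x + y)).
have us : uniq s by exact: undup_uniq.
have [sx sy sz] : [/\ {subset gsupp x <= s}, {subset gsupp y <= s}
    & {subset gsupp (a *: x + y) <= s}].
  by split=> n; rewrite mem_undup !mem_cat => ->; rewrite ?orbT.
rewrite !(by_degree_widen (s := s)) //.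
rewrite scaler_sumr -big_split; apply: eq_bigr => n _ /=.
by rewrite linearP lF.
Qed.

Lemma by_degree_homog F n x :
  (forall m, F m 0 = 0) -> homog n x -> by_degree F x = F n x.
Proof.
move=> F0 hx; have us := undup_uniq (n :: gsupp x).
rewrite (by_degree_widen (s := undup (n :: gsupp x))) //; last first.
  by move=> m; rewrite mem_undup inE => ->; rewrite orbT.
rewrite (bigD1_seq n) ?mem_undup ?inE ?eqxx //= hx big1 ?addr0 // => m mn.
by rewrite (homog_proj m hx) (negPf mn) F0.
Qed.
End ByDegree.

Lemma gproj_bigsum (K : fieldType) (X : gradedVectType K) n (I : Type)
    (r : seq I) (F : I -> X) :
  gproj n (\sum_(i <- r) F i) = \sum_(i <- r) gproj n (F i).
Proof. exact: (linear_sum (gproj n : {linear X -> X})). Qed.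

Lemma homogD (K : fieldType) (X : gradedVectType K) n (x y : X) :
  homog n x -> homog n y -> homog n (x + y).
Proof. by rewrite /homog => hx hy; rewrite linearD /= hx hy. Qed.

Lemma homogZ (K : fieldType) (X : gradedVectType K) n a (x : X) :
  homog n x -> homog n (a *: x).
Proof. by rewrite /homog => hx; rewrite linearZ /= hx. Qed.

Lemma homog_sum (K : fieldType) (X : gradedVectType K) n (I : eqType)
    (r : seq I) (F : I -> X) :
  (forall i, i \in r -> homog n (F i)) -> homog n (\sum_(i <- r) F i).
Proof.
move=> h; rewrite big_seq; elim/big_ind: _ => //; first exact: homog0.
exact: homogD.
Qed.

Section GradingFromSpan.
Variables (K : fieldType) (V : lmodType K) (q : int -> V -> V).
Hypothesis q_linear : forall n, linear (q n).

Let homq n (v : V) := forall m, q m v = if m == n then v else 0.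

Definition hspan (v : V) : Prop := exists s : seq (int * V),
  (forall p, p \in s -> homq p.1 p.2) /\ v = \sum_(p <- s) p.2.

Let qsum m (I : Type) (r : seq I) (F : I -> V) :
  q m (\sum_(i <- r) F i) = \sum_(i <- r) q m (F i).
Proof.
pose qm : {linear V -> V} :=
  HB.pack (q m) (GRing.isLinear.Build K V V *:%R (q m) (@q_linear m)).
exact: (linear_sum qm).
Qed.

Let q0 m : q m 0 = 0.
Proof. by have := qsum m [::] (fun _ : nat => 0); rewrite !big_nil. Qed.

Lemma hspan_proj v m n : hspan v -> q m (q n v) = if m == n then q n v else 0.
Proof.
case=> s [hs ->]; rewrite !qsum (_ : (if _ then _ else _) =
  \sum_(p <- s) if m == n then q n p.2 else 0); last first.
  by case: eqP => // _; rewrite big1.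
rewrite big_seq [RHS]big_seq; apply: eq_bigr => p /hs hp; rewrite (hp n).
have [np|np] := eqVneq n p.1; first by rewrite hp -np.
by rewrite q0 if_same.
Qed.

Lemma hspan_sum v : hspan v ->
  exists s : seq int, uniq s && (v == \sum_(n <- s) q n v).
Proof.
case=> s [hs ->]; exists (undup [seq p.1 | p <- s]).
rewrite undup_uniq /=; apply/eqP.
under [RHS]eq_bigr do rewrite qsum.
rewrite exchange_big /= big_seq [RHS]big_seq; apply: eq_bigr => p ps.
rewrite (bigD1_seq p.1) ?undup_uniq ?mem_undup ?map_f //= (hs _ ps) eqxx.
by rewrite big1 ?addr0 // => n np; rewrite (hs _ ps) (negPf np).
Qed.

Lemma hspan_comb (I : Type) (r : seq I) (c : I -> K) (F : I -> V) :
  (forall i, hspan (F i)) -> hspan (\sum_(i <- r) c i *: F i).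
Proof.
move=> hF; elim: r => [|i r [s [hs es]]].
  by exists [::]; rewrite !big_nil.
have [t [ht et]] := hF i.
exists ([seq (p.1, c i *: p.2) | p <- t] ++ s); split.
  move=> p; rewrite mem_cat => /orP[/mapP[u /ht hu ->]|/hs //] m /=.
  have := @q_linear m (c i) u.2 0; rewrite !addr0 => ->.
  by rewrite q0 addr0 hu; case: eqP => _ //; rewrite scaler0.
by rewrite big_cons big_cat big_map /= -es et scaler_sumr.
Qed.
End GradingFromSpan.

Section Tensor.
Variables (K : fieldType) (U V : gradedVectType K).

Definition bilin (W : lmodType K) (f : U * V -> W) : Prop :=
  (forall v, linear (fun u => f (u, v))) /\ (forall u, linear (fun v => f (u, v))).

Definition tensor : Type := pres bilin.
HB.instance Definition _ := GRing.Lmodule.copy tensor (pres bilin).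

Definition tens (u : U) (v : V) : tensor := pgen bilin (u, v).

(* The linear map u (x) v |-> f u v; meaningful only when f is bilinear. *)
Definition tlift (W : lmodType K) (f : U -> V -> W) : tensor -> W :=
  @plift K _ bilin W (fun p => f p.1 p.2).

Definition bilinear2 (W : lmodType K) (f : U -> V -> W) : Prop :=
  (forall v, linear (fun u => f u v)) /\ (forall u, linear (f u)).

Lemma tlift_linear (W : lmodType K) (f : U -> V -> W) :
  bilinear2 f -> linear (tlift f).
Proof. by move=> bf; apply: plift_linear. Qed.

Lemma tlift_tens (W : lmodType K) (f : U -> V -> W) u v :
  bilinear2 f -> tlift f (tens u v) = f u v.
Proof. by move=> bf; rewrite /tlift /tens plift_gen. Qed.

Lemma tens_bilinear : bilinear2 tens.
Proof.
split=> [v|u] a x y; apply: pres_ext => W f bf;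
  rewrite (plift_linear bf) !plift_gen //; case: bf => l1 l2.
- exact: l1.
- exact: l2.
Qed.

Lemma tens_spanned (t : tensor) : exists s : seq (K * (U * V)),
  t = \sum_(p <- s) p.1 *: tens p.2.1 p.2.2.
Proof.
have [s ->] := pres_spanned t; exists s.
by apply: eq_bigr => -[c [u v]].
Qed.

Lemma tens_ext (W : lmodType K) (f g : tensor -> W) : linear f -> linear g ->
  (forall u v, f (tens u v) = g (tens u v)) -> f =1 g.
Proof.
move=> lf lg fg t; have [s ->] := tens_spanned t.
pose f' : {linear tensor -> W} :=
  HB.pack f (GRing.isLinear.Build K _ W *:%R f lf).
pose g' : {linear tensor -> W} :=
  HB.pack g (GRing.isLinear.Build K _ W *:%R g lg).
rewrite -[f]/(f' : _ -> _) -[g]/(g' : _ -> _) !linear_sum.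
by apply: eq_bigr => p _; rewrite !linearZ /= fg.
Qed.

Lemma tens_suml (I : Type) (r : seq I) (F : I -> U) v :
  tens (\sum_(i <- r) F i) v = \sum_(i <- r) tens (F i) v.
Proof.
pose g : {linear U -> tensor} := HB.pack (fun u => tens u v)
  (GRing.isLinear.Build K U tensor *:%R _ (tens_bilinear.1 v)).
exact: (linear_sum g).
Qed.

Lemma tens_sumr (I : Type) (r : seq I) (F : I -> V) u :
  tens u (\sum_(i <- r) F i) = \sum_(i <- r) tens u (F i).
Proof.
pose g : {linear V -> tensor} := HB.pack (tens u)
  (GRing.isLinear.Build K V tensor *:%R _ (tens_bilinear.2 u)).
exact: (linear_sum g).
Qed.

Lemma tens0l v : tens 0 v = 0.
Proof. by have := tens_suml [::] (fun _ : nat => 0) v; rewrite !big_nil. Qed.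

Lemma tens0r u : tens u 0 = 0.
Proof. by have := tens_sumr [::] (fun _ : nat => 0) u; rewrite !big_nil. Qed.

Definition tproj (n : int) : tensor -> tensor :=
  tlift (fun u v => by_degree (fun i u' => tens u' (gproj (n - i) v)) u).

Lemma tproj_bilinear n : bilinear2
  (fun u v => by_degree (fun i u' => tens u' (gproj (n - i) v)) u).
Proof.
split=> [v|u a x y].
  by apply: by_degree_linear => i; exact: tens_bilinear.1.
rewrite /by_degree scaler_sumr -big_split; apply: eq_bigr => i _ /=.
by rewrite linearP tens_bilinear.2.
Qed.

Lemma tproj_linear n : linear (tproj n).
Proof. exact/tlift_linear/tproj_bilinear. Qed.

Lemma tproj_tens i j u v m : homog i u -> homog j v ->
  tproj m (tens u v) = if m == i + j then tens u v else 0.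
Proof.
move=> hu hv; rewrite /tproj tlift_tens; last exact: tproj_bilinear.
rewrite (by_degree_homog (n := i)) //; last by move=> k; rewrite tens0l.
rewrite (homog_proj _ hv) subr_eq addrC.
by case: eqP => // _; rewrite tens0r.
Qed.

Lemma tensor_hspan t : hspan tproj t.
Proof.
have [s ->] := tens_spanned t.
apply: (hspan_comb tproj_linear) => -[c [u v]] /=.
exists [seq (i + j, tens (gproj i u) (gproj j v)) | i <- gsupp u, j <- gsupp v].
split.
  move=> p /allpairsP[[i j] [_ _ ->]] m /=.
  by apply: tproj_tens; exact: homog_gproj.
rewrite big_allpairs_dep /= {1}(gsupp_sum u) tens_suml; apply: eq_bigr => i _.
by rewrite {1}(gsupp_sum v) tens_sumr.
Qed.

Lemma tproj_proj m n t : tproj m (tproj n t) = if m == n then tproj n t else 0.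
Proof. exact/hspan_proj/tensor_hspan/tproj_linear. Qed.

Lemma tproj_sum t :
  exists s : seq int, uniq s && (t == \sum_(n <- s) tproj n t).
Proof. exact/hspan_sum/tensor_hspan/tproj_linear. Qed.

HB.instance Definition _ :=
  isGraded.Build K tensor tproj_linear tproj_proj tproj_sum.

Lemma tens_homog i j u v : homog i u -> homog j v -> homog (i + j) (tens u v).
Proof. by move=> hu hv; rewrite /homog [LHS](tproj_tens _ hu hv) eqxx. Qed.

End Tensor.

Notation "u \ox v" := (tens u v) (at level 40, left associativity).

Section Words.
Variables (K : fieldType) (X : gradedVectType K).

Definition multilin (W : lmodType K) (f : seq X -> W) : Prop :=
  forall (u v : seq X) (a : K) (x y : X),
    f (u ++ (a *: x + y) :: v) = a *: f (u ++ x :: v) + f (u ++ y :: v).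

(* The direct sum of the tensor powers of X: a map seq X -> W satisfying
   multilin is a family, indexed by k, of k-linear maps X^k -> W. *)
Definition Tc : Type := pres multilin.
HB.instance Definition _ := GRing.Lmodule.copy Tc (pres multilin).

(* word [:: x1; ...; xk] is x1 (x) ... (x) xk. *)
Definition word (w : seq X) : Tc := pgen multilin w.

(* The linear map x1 (x) ... (x) xk |-> f [:: x1; ...; xk]; meaningful only
   when f is multilinear. *)
Definition wlift (W : lmodType K) (f : seq X -> W) : Tc -> W :=
  @plift K _ multilin W f.

Lemma wlift_linear (W : lmodType K) (f : seq X -> W) :
  multilin f -> linear (wlift f).
Proof. exact: plift_linear. Qed.

Lemma wlift_word (W : lmodType K) (f : seq X -> W) w :
  multilin f -> wlift f (word w) = f w.
Proof. exact: plift_gen. Qed.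

Lemma word_multilin : multilin word.
Proof.
move=> u v a x y; apply: pres_ext => W f mf.
by rewrite (plift_linear mf) !plift_gen.
Qed.

Lemma Tc_spanned (t : Tc) :
  exists s : seq (K * seq X), t = \sum_(p <- s) p.1 *: word p.2.
Proof. exact: pres_spanned. Qed.

Lemma Tc_ext (W : lmodType K) (f g : Tc -> W) : linear f -> linear g ->
  (forall w, f (word w) = g (word w)) -> f =1 g.
Proof.
move=> lf lg fg t; have [s ->] := Tc_spanned t.
pose f' : {linear Tc -> W} :=
  HB.pack f (GRing.isLinear.Build K Tc W *:%R f lf).
pose g' : {linear Tc -> W} :=
  HB.pack g (GRing.isLinear.Build K Tc W *:%R g lg).
rewrite -[f]/(f' : _ -> _) -[g]/(g' : _ -> _) !linear_sum.
by apply: eq_bigr => p _; rewrite !linearZ /= fg.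
Qed.

Definition lcons (x : X) : Tc -> Tc := wlift (fun w => word (x :: w)).

Lemma lcons_multilin x : multilin (fun w => word (x :: w)).
Proof. by move=> u v a y z; exact: (word_multilin (x :: u)). Qed.

Lemma lcons_linear x : linear (lcons x).
Proof. exact/wlift_linear/lcons_multilin. Qed.

Lemma lcons_word x w : lcons x (word w) = word (x :: w).
Proof. exact/wlift_word/lcons_multilin. Qed.

HB.instance Definition _ x :=
  GRing.isLinear.Build K Tc Tc *:%R (lcons x) (lcons_linear x).

Lemma lcons_sum x (I : Type) (r : seq I) (F : I -> Tc) :
  lcons x (\sum_(i <- r) F i) = \sum_(i <- r) lcons x (F i).
Proof. exact: (linear_sum (lcons x : {linear Tc -> Tc})). Qed.

Lemma lcons_linearl t : linear (fun x => lcons x t).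
Proof.
move=> a x y; move: t; apply: Tc_ext; first exact: lcons_linear.
  move=> b t u /=; rewrite !lcons_linear !scalerDr !scalerA mulrC -!addrA.
  by congr (_ + _); rewrite addrCA.
by move=> w; rewrite !lcons_word (word_multilin [::]).
Qed.

(* The component of degree n of a word, where a word of homogeneous letters
   has degree the sum of the degrees of its letters (see word_homog). *)
Fixpoint wproj (n : int) (w : seq X) : Tc :=
  if w is x :: w' then by_degree (fun i x' => lcons x' (wproj (n - i) w')) x
  else if n == 0 then word [::] else 0.

Lemma wproj_multilin n : multilin (wproj n).
Proof.
move=> u v a x y; elim: u n => [|z u IH] n /=.
  by apply: by_degree_linear => i; exact: lcons_linearl.
rewrite /by_degree scaler_sumr -big_split; apply: eq_bigr => i _ /=.
by rewrite IH linearP.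
Qed.

Definition Tproj (n : int) : Tc -> Tc := wlift (wproj n).

Lemma Tproj_linear n : linear (Tproj n).
Proof. exact/wlift_linear/wproj_multilin. Qed.

Lemma Tproj_word n w : Tproj n (word w) = wproj n w.
Proof. exact/wlift_word/wproj_multilin. Qed.

Let lcons0 t : lcons 0 t = 0.
Proof. by have := lcons_linearl t (-1) 0 0; rewrite scaler0 addr0 scaleN1r addNr. Qed.

Lemma Tproj_lcons n i x t :
  homog i x -> Tproj n (lcons x t) = lcons x (Tproj (n - i) t).
Proof.
move=> hx; move: t; apply: Tc_ext.
- by move=> a t u; rewrite linearP Tproj_linear.
- by move=> a t u; rewrite Tproj_linear linearP.
move=> w; rewrite lcons_word !Tproj_word /=.
by rewrite (by_degree_homog (n := i)).
Qed.

Lemma Tc_hspan t : hspan Tproj t.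
Proof.
have [s ->] := Tc_spanned t.
apply: (hspan_comb Tproj_linear) => -[c w] /=.
elim: w => [|x w [r [hr er]]].
  exists [:: (0, word [::])]; split; last by rewrite big_seq1.
  by move=> p; rewrite inE => /eqP -> m; rewrite Tproj_word /=.
exists [seq (i + p.1, lcons (gproj i x) p.2) | i <- gsupp x, p <- r]; split.
  move=> q /allpairsP[[i p] [_ pr ->]] m /=.
  rewrite (Tproj_lcons _ _ (homog_gproj i x)) (hr _ pr) subr_eq addrC.
  by case: eqP => // _; rewrite linear0.
rewrite big_allpairs_dep /= -lcons_word {1}(gsupp_sum x).
pose g : {linear X -> Tc} := HB.pack (fun x => lcons x (word w))
  (GRing.isLinear.Build K X Tc *:%R _ (lcons_linearl (word w))).
rewrite [LHS](linear_sum g); apply: eq_bigr => i _.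
by rewrite /g /= er linear_sum.
Qed.

Lemma Tproj_proj m n t : Tproj m (Tproj n t) = if m == n then Tproj n t else 0.
Proof. exact/hspan_proj/Tc_hspan/Tproj_linear. Qed.

Lemma Tproj_sum t :
  exists s : seq int, uniq s && (t == \sum_(n <- s) Tproj n t).
Proof. exact/hspan_sum/Tc_hspan/Tproj_linear. Qed.

HB.instance Definition _ :=
  isGraded.Build K Tc Tproj_linear Tproj_proj Tproj_sum.

Lemma word_homog (s : seq (int * X)) : (forall p, p \in s -> homog p.1 p.2) ->
  homog (\sum_(p <- s) p.1) (word [seq p.2 | p <- s]).
Proof.
elim: s => [|p s IH] h.
  by rewrite big_nil /homog [LHS]Tproj_word.
have hp : homog p.1 p.2 by apply: h; rewrite mem_head.
rewrite big_cons /= /homog -lcons_word [LHS](Tproj_lcons _ _ hp).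
rewrite addrC addrA addNr add0r [Tproj _ _]IH // => q qs.
by apply: h; rewrite inE qs orbT.
Qed.
End Words.

Definition has_degree (K : fieldType) (X Y : gradedVectType K) (k : int)
    (f : X -> Y) : Prop :=
  forall n x, homog n x -> homog (n + k) (f x).

Section Koszul.
Variable K : fieldType.

(* f (x) g for linear maps f and g with g of degree k, under the Koszul sign
   rule: u (x) v |-> (-1)^(k |u|) f u (x) g v. *)
Definition ktens (U V U' V' : gradedVectType K) (k : int)
    (f : U -> U') (g : V -> V') : tensor U V -> tensor U' V' :=
  tlift (fun u v =>
    by_degree (fun i u' => (-1) ^ (k * i) *: (f u' \ox g v)) u).

Definition twist (U V : gradedVectType K) : tensor U V -> tensor V U :=
  tlift (fun u v =>
    by_degree (fun i u' =>
      by_degree (fun j v' => (-1) ^ (i * j) *: (v' \ox u')) v) u).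

(* id (x) twist (x) id, from (A (x) B) (x) (C (x) D) to
   (A (x) C) (x) (B (x) D). *)
Definition midswap (A B C D : gradedVectType K) :
    tensor (tensor A B) (tensor C D) -> tensor (tensor A C) (tensor B D) :=
  tlift (fun p q =>
    tlift (fun a b =>
      tlift (fun c d =>
        tlift (fun c' b' => (a \ox c') \ox (b' \ox d)) (twist (b \ox c))) q) p).

Lemma bilinear_comb (U V : gradedVectType K) (W : lmodType K) (c : K)
    (f : U -> V -> W) : bilinear2 f -> bilinear2 (fun u v => c *: f u v).
Proof.
by case=> l r; split=> [v|u] a x y; rewrite ?l ?r scalerDr !scalerA mulrC.
Qed.

Lemma ktens_bilinear (U V U' V' : gradedVectType K) k
    (f : {linear U -> U'}) (g : {linear V -> V'}) :
  bilinear2 (fun u v =>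
    by_degree (fun i u' => (-1) ^ (k * i) *: (f u' \ox g v)) u).
Proof.
have [tl tr] := tens_bilinear U' V'.
split=> [v|u a x y].
  apply: by_degree_linear => i a x y.
  by rewrite linearP tl scalerDr !scalerA mulrC.
rewrite /by_degree scaler_sumr -big_split; apply: eq_bigr => i _ /=.
by rewrite linearP tr scalerDr !scalerA mulrC.
Qed.

Lemma ktens_tens (U V U' V' : gradedVectType K) k
    (f : {linear U -> U'}) (g : {linear V -> V'}) i u v : homog i u ->
  ktens k f g (u \ox v) = (-1) ^ (k * i) *: (f u \ox g v).
Proof.
move=> hu; rewrite /ktens tlift_tens; last exact: ktens_bilinear.
by rewrite (by_degree_homog _ hu) // => m; rewrite linear0 tens0l scaler0.
Qed.

Lemma ktens0_tens (U V U' V' : gradedVectType K)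
    (f : {linear U -> U'}) (g : {linear V -> V'}) u v :
  ktens 0 f g (u \ox v) = f u \ox g v.
Proof.
rewrite /ktens tlift_tens; last exact: ktens_bilinear.
rewrite {2}(gsupp_sum u) linear_sum tens_suml; apply: eq_bigr => i _.
by rewrite mul0r expr0z scale1r.
Qed.

Lemma twist_bilinear (U V : gradedVectType K) : bilinear2 (fun (u : U) (v : V) =>
  by_degree (fun i u' =>
    by_degree (fun j v' => (-1) ^ (i * j) *: (v' \ox u')) v) u).
Proof.
have [tl tr] := tens_bilinear V U.
split=> [v|u a x y].
  apply: by_degree_linear => i a x y.
  rewrite /by_degree scaler_sumr -big_split; apply: eq_bigr => j _ /=.
  by rewrite tr scalerDr !scalerA mulrC.
rewrite /by_degree scaler_sumr -big_split; apply: eq_bigr => i _ /=.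
pose F j (v' : V) := (-1) ^ (i * j) *: (v' \ox gproj i u).
have lF j : linear (F j).
  by move=> b z t; rewrite /F tl scalerDr !scalerA mulrC.
exact: (by_degree_linear lF).
Qed.

Lemma twist_tens (U V : gradedVectType K) i j (u : U) (v : V) :
  homog i u -> homog j v -> twist (u \ox v) = (-1) ^ (i * j) *: (v \ox u).
Proof.
move=> hu hv; rewrite /twist tlift_tens; last exact: twist_bilinear.
rewrite (by_degree_homog _ hu).
  by rewrite (by_degree_homog _ hv) // => m; rewrite tens0l scaler0.
by move=> m; rewrite /by_degree big1 // => n _; rewrite tens0r scaler0.
Qed.

Lemma twist_linear (U V : gradedVectType K) : linear (@twist U V).
Proof. exact/tlift_linear/twist_bilinear. Qed.

Section Midswap.
Variables A B C D : gradedVectType K.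

Let mid4 (a : A) (d : D) := fun (c : C) (b : B) => (a \ox c) \ox (b \ox d).
Let mid3 (a : A) (b : B) := fun (c : C) (d : D) =>
  tlift (mid4 a d) (twist (b \ox c)).
Let mid2 (q : tensor C D) := fun (a : A) (b : B) => tlift (mid3 a b) q.

Let mid4_bilinear a d : bilinear2 (mid4 a d).
Proof.
split=> [b|c] k x y; rewrite /mid4.
  by rewrite (tens_bilinear A C).2 (tens_bilinear _ _).1.
by rewrite (tens_bilinear B D).1 (tens_bilinear _ _).2.
Qed.

Let mid3_bilinear a b : bilinear2 (mid3 a b).
Proof.
split=> [d|c] k x y; rewrite /mid3.
  rewrite (tens_bilinear B C).2 twist_linear.
  exact: (tlift_linear (mid4_bilinear a d)).
apply: plift_comb => p; rewrite /mid4.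
by rewrite (tens_bilinear B D).2 (tens_bilinear _ _).2.
Qed.

Let mid2_bilinear q : bilinear2 (mid2 q).
Proof.
split=> [b|a] k x y; apply: plift_comb => p; rewrite /mid3.
  apply: plift_comb => r; rewrite /mid4.
  by rewrite (tens_bilinear A C).1 (tens_bilinear _ _).1.
rewrite (tens_bilinear B C).1 twist_linear.
exact: (tlift_linear (mid4_bilinear a p.2)).
Qed.

Let mid_bilinear : bilinear2 (fun (p : tensor A B) q => tlift (mid2 q) p).
Proof.
split=> [q|p] k x y; first exact: (tlift_linear (mid2_bilinear q)).
apply: plift_comb => r; exact: (tlift_linear (mid3_bilinear r.1 r.2)).
Qed.

Lemma midswap_linear : linear (@midswap A B C D).
Proof. exact: (tlift_linear mid_bilinear). Qed.

Lemma midswap_tens i j a b c d : homog i b -> homog j c ->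
  midswap ((a \ox b) \ox (c \ox d)) =
    (-1) ^ (i * j) *: ((a \ox c) \ox (b \ox d) : tensor (tensor A C) (tensor B D)).
Proof.
move=> hb hc.
rewrite /midswap tlift_tens; last exact: mid_bilinear.
rewrite tlift_tens; last exact: mid2_bilinear.
rewrite tlift_tens; last exact: mid3_bilinear.
have lm := tlift_linear (mid4_bilinear a d).
pose g : {linear tensor C B -> _} :=
  HB.pack (tlift (mid4 a d)) (GRing.isLinear.Build K _ _ *:%R _ lm).
by rewrite (twist_tens hb hc) -[LHS]/(g _) linearZ /= tlift_tens.
Qed.

End Midswap.
End Koszul.

Section TensorCoalgebra.
Variables (K : fieldType) (X : gradedVectType K).

Definition deconc : Tc X -> tensor (Tc X) (Tc X) :=
  wlift (fun w => \sum_(i < (size w).+1) word (take i w) \ox word (drop i w)).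

Definition counit : Tc X -> K^o := wlift (fun w => (nilp w)%:R : K^o).

Definition proj1 : Tc X -> X := wlift (fun w => if w is [:: x] then x else 0).

Definition in1 (x : X) : Tc X := word [:: x].

(* Membership in the sum of the tensor powers of positive exponent, which is
   the kernel of the counit. *)
Definition reduced (t : Tc X) : Prop := counit t = 0.

Definition conc2 (s t : Tc X) : Tc X :=
  wlift (fun u => wlift (fun v => word (u ++ v)) t) s.

Definition conc : tensor (Tc X) (Tc X) -> Tc X := tlift conc2.

Definition deconc2 (t : tensor (Tc X) (Tc X)) :
    tensor (tensor (Tc X) (Tc X)) (tensor (Tc X) (Tc X)) :=
  midswap (ktens 0 deconc deconc t).

Definition counit2 : tensor (Tc X) (Tc X) -> K^o :=
  tlift (fun a b => counit a * counit b).

Lemma deconc_multilin : multilin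
  (fun w : seq X => \sum_(i < (size w).+1) word (take i w) \ox word (drop i w)).
Proof.
move=> u v a x y; rewrite !size_cat /= scaler_sumr -big_split.
apply: eq_bigr => i _ /=; rewrite !take_cat !drop_cat.
case: ltnP => [iu|ui].
  by rewrite (word_multilin (drop i u)) (tens_bilinear _ _).2.
case: (i - size u)%N => [|k] /=.
  by rewrite (word_multilin [::]) (tens_bilinear _ _).2.
by rewrite (word_multilin u) (tens_bilinear _ _).1.
Qed.

Lemma deconc_linear : linear deconc.
Proof. exact/wlift_linear/deconc_multilin. Qed.

Lemma deconc_word w :
  deconc (word w) = \sum_(i < (size w).+1) word (take i w) \ox word (drop i w).
Proof. exact/wlift_word/deconc_multilin. Qed.

HB.instance Definition _ :=
  GRing.isLinear.Build K (Tc X) _ *:%R deconc deconc_linear.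

Lemma counit_multilin : multilin (fun w : seq X => (nilp w)%:R : K^o).
Proof. by move=> [|z u] v a x y /=; rewrite scaler0 addr0. Qed.

Lemma counit_linear : linear counit.
Proof. exact/wlift_linear/counit_multilin. Qed.

Lemma counit_word w : counit (word w) = (nilp w)%:R.
Proof. exact/wlift_word/counit_multilin. Qed.

HB.instance Definition _ :=
  GRing.isLinear.Build K (Tc X) K^o *:%R counit counit_linear.

Lemma proj1_multilin :
  multilin (fun w : seq X => if w is [:: x] then x else 0).
Proof.
by move=> [|z [|z' u]] [|t v] a x y //=; rewrite scaler0 addr0.
Qed.

Lemma proj1_linear : linear proj1.
Proof. exact/wlift_linear/proj1_multilin. Qed.

Lemma proj1_word w : proj1 (word w) = if w is [:: x] then x else 0.
Proof. exact/wlift_word/proj1_multilin. Qed.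

HB.instance Definition _ :=
  GRing.isLinear.Build K (Tc X) X *:%R proj1 proj1_linear.

Lemma in1_linear : linear in1.
Proof. by move=> a x y; rewrite /in1 (word_multilin [::]). Qed.

HB.instance Definition _ := GRing.isLinear.Build K X (Tc X) *:%R in1 in1_linear.

Let catr_multilin u : multilin (fun v : seq X => word (u ++ v)).
Proof. by move=> v v' a x y; rewrite !catA word_multilin. Qed.

Let catl_multilin t : multilin (fun u : seq X => wlift (fun v => word (u ++ v)) t).
Proof.
move=> u v a x y; apply: plift_comb => w.
by rewrite -!catA !cat_cons word_multilin.
Qed.

Lemma conc2_bilinear : bilinear2 conc2.
Proof.
split=> [t|s]; first exact: wlift_linear.
by move=> a t t'; apply: plift_comb => u; rewrite wlift_linear.
Qed.

Lemma conc_linear : linear conc.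
Proof. exact/tlift_linear/conc2_bilinear. Qed.

HB.instance Definition _ :=
  GRing.isLinear.Build K (tensor (Tc X) (Tc X)) (Tc X) *:%R conc conc_linear.

Lemma conc_sum (I : Type) (r : seq I) (F : I -> tensor (Tc X) (Tc X)) :
  conc (\sum_(i <- r) F i) = \sum_(i <- r) conc (F i).
Proof. exact: (linear_sum (conc : {linear tensor (Tc X) (Tc X) -> Tc X})). Qed.

Lemma conc_tens s t : conc (s \ox t) = conc2 s t.
Proof. exact/tlift_tens/conc2_bilinear. Qed.

Lemma conc_word u v : conc (word u \ox word v) = word (u ++ v).
Proof. by rewrite conc_tens /conc2 !wlift_word. Qed.

Lemma conc1l t : conc (word [::] \ox t) = t.
Proof.
rewrite conc_tens; move: t; apply: Tc_ext => //; first exact: conc2_bilinear.2.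
by move=> w; rewrite -conc_tens conc_word.
Qed.

Lemma conc1r t : conc (t \ox word [::]) = t.
Proof.
rewrite conc_tens; move: t; apply: Tc_ext => //; first exact: conc2_bilinear.1.
by move=> w; rewrite -conc_tens conc_word cats0.
Qed.

Lemma concA a b c : conc (conc (a \ox b) \ox c) = conc (a \ox conc (b \ox c)).
Proof.
have [tl tr] := tens_bilinear (Tc X) (Tc X).
move: a; apply: Tc_ext => [k x y|k x y|u].
- by rewrite tl linearP tl linearP.
- by rewrite tl linearP.
move: b; apply: Tc_ext => [k x y|k x y|v].
- by rewrite tr linearP tl linearP.
- by rewrite tl linearP tr linearP.
move: c; apply: Tc_ext => [k x y|k x y|w].
- by rewrite tr linearP.
- by rewrite tr linearP tr linearP.
by rewrite !conc_word catA.
Qed.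

Lemma conc_lcons x s t : conc (lcons x s \ox t) = lcons x (conc (s \ox t)).
Proof.
have lc u : lcons x u = conc (in1 x \ox u).
  move: u; apply: Tc_ext => [k u v|k u v|w]; first by rewrite linearP.
    by rewrite (tens_bilinear _ _).2 linearP.
  by rewrite lcons_word conc_word.
by rewrite !lc concA.
Qed.

Lemma gproj_conc n s t : gproj n (conc (s \ox t)) = conc (gproj n (s \ox t)).
Proof.
have [tl tr] := tens_bilinear (Tc X) (Tc X).
move: s; apply: Tc_ext => [k x y|k x y|w].
- by rewrite tl !linearP.
- by rewrite tl !linearP.
elim: w n => [|x w IH] n.
  rewrite conc1l [in RHS](gsupp_sum t) tens_sumr gproj_bigsum linear_sum /=.
  rewrite [in LHS](gsupp_sum t) gproj_bigsum; apply: eq_bigr => i _ /=.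
  have h0 : homog 0 (word [::] : Tc X) by rewrite /homog [LHS]Tproj_word.
  rewrite gproj_proj (homog_proj _ (tens_homog h0 (homog_gproj i t))) add0r.
  by case: eqP => _; rewrite ?linear0 // conc1l.
pose L (x : X) := gproj n (conc (lcons x (word w) \ox t)).
pose R (x : X) := conc (gproj n (lcons x (word w) \ox t)).
have lL : linear L.
  by move=> a y z; rewrite /L lcons_linearl tl !linearP.
have lR : linear R.
  by move=> a y z; rewrite /R lcons_linearl tl !linearP.
pose L' : {linear X -> Tc X} := HB.pack L (GRing.isLinear.Build K _ _ *:%R L lL).
pose R' : {linear X -> Tc X} := HB.pack R (GRing.isLinear.Build K _ _ *:%R R lR).
rewrite -lcons_word -[LHS]/(L' x) -[RHS]/(R' x) (gsupp_sum x) !linear_sum.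
apply: eq_bigr => i _; rewrite /L' /R' /= /L /R {L R lL lR L' R'}.
have := homog_gproj i x; move: (gproj i x) => {}x hx.
rewrite conc_lcons [LHS](Tproj_lcons _ _ hx) [Tproj _ _]IH.
move: (word w) => s; rewrite (gsupp_sum s) lcons_sum !tens_suml.
rewrite !(conc_sum, gproj_bigsum, lcons_sum).
apply: eq_bigr => j _; have := homog_gproj j s.
move: (gproj j s) => {}s hs.
rewrite (gsupp_sum t) !tens_sumr.
rewrite !(conc_sum, gproj_bigsum, lcons_sum).
apply: eq_bigr => l _; have ht := homog_gproj l t.
have hxs : homog (i + j) (lcons x s).
  by rewrite /homog [LHS](Tproj_lcons _ _ hx) addrC addKr [Tproj _ _]hs.
rewrite (homog_proj _ (tens_homog hs ht)) (homog_proj _ (tens_homog hxs ht)).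
rewrite subr_eq addrC addrA; case: eqP => _; last by rewrite !linear0.
by rewrite conc_lcons.
Qed.

Lemma conc_degree : has_degree 0 conc.
Proof.
move=> n t ht; rewrite addr0 /homog -{2}ht.
move: t {ht}; apply: tens_ext => [a x y|a x y|s t].
- by rewrite !linearP.
- by rewrite !linearP.
exact: gproj_conc.
Qed.

Lemma one_homog : homog 0 (word [::] : Tc X).
Proof. by rewrite /homog [LHS]Tproj_word. Qed.

Lemma in1_degree : has_degree 0 in1.
Proof.
move=> n x hx; rewrite addr0 /homog -{2}hx /in1 -!lcons_word.
rewrite [LHS](Tproj_lcons _ _ hx) subrr; congr lcons => //.
exact: one_homog.
Qed.

Lemma counit2_bilinear : bilinear2 (fun a b => counit a * counit b : K^o).
Proof.
split=> [b|b] k x y; rewrite linearP /=; first by rewrite mulrDl scalerAl.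
by rewrite mulrDr -scalerAr.
Qed.

Lemma counit2_tens a b : counit2 (a \ox b) = counit a * counit b.
Proof. exact/tlift_tens/counit2_bilinear. Qed.

End TensorCoalgebra.

Section Binfinity.
Variable K : fieldType.

(* The map d (x) id + id (x) d for d of degree -1. *)
Definition leibniz (V : gradedVectType K) (d : V -> V) (t : tensor V V) :
    tensor V V :=
  ktens 0 d idfun t + ktens (-1) idfun d t.

(* The unit of Tc X is word [::], the generator of the tensor power of exponent
   0; deconc2 and counit2 are the coalgebra structure of Tc X (x) Tc X. *)
Record Binf (X : gradedVectType K) : Type := MkBinf {
  bmul : {linear tensor (Tc X) (Tc X) -> Tc X};
  bdiff : {linear Tc X -> Tc X};
  bmul_degree : has_degree 0 bmul;
  bmul_deconc : forall t, deconc (bmul t) = ktens 0 bmul bmul (deconc2 t);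
  bmul_counit : forall t, counit (bmul t) = counit2 t;
  bmulA : forall a b c, bmul (bmul (a \ox b) \ox c) = bmul (a \ox bmul (b \ox c));
  bmul1l : forall a, bmul (word [::] \ox a) = a;
  bmul1r : forall a, bmul (a \ox word [::]) = a;
  bdiff_degree : has_degree (-1) bdiff;
  bdiff_deconc : forall t, deconc (bdiff t) = leibniz bdiff (deconc t);
  bdiff1 : bdiff (word [::]) = 0;
  bdiff_sq : forall t, bdiff (bdiff t) = 0;
  bdiff_bmul : forall t, bdiff (bmul t) = bmul (leibniz bdiff t)
}.

(* The structure maps m_n and m_(i,j), as multilinear maps on tuples. *)
Definition bm (X : gradedVectType K) (B : Binf X) n (x : n.-tuple X) : X :=
  proj1 (bdiff B (word x)).

Definition bm2 (X : gradedVectType K) (B : Binf X) i j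
    (x : i.-tuple X) (y : j.-tuple X) : X :=
  proj1 (bmul B (word x \ox word y)).

Record Binf_hom (X Y : gradedVectType K) (B : Binf X) (C : Binf Y)
    (f : {linear X -> Y}) : Prop := MkBinf_hom {
  hom_degree : has_degree 0 f;
  hom_bm : forall n (x : n.-tuple X), (0 < n)%N ->
    f (bm B x) = bm C (map_tuple f x);
  hom_bm2 : forall i j (x : i.-tuple X) (y : j.-tuple X),
    (0 < i)%N -> (0 < j)%N ->
    f (bm2 B x y) = bm2 C (map_tuple f x) (map_tuple f y)
}.

Record TwoAssDiffAlg (V : gradedVectType K) : Type := MkTwoAssDiffAlg {
  bul : {linear tensor V V -> V};
  odot : {linear tensor V V -> V};
  unit2 : V;
  del : {linear V -> V};
  bul_degree : has_degree 0 bul;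
  odot_degree : has_degree 0 odot;
  unit2_degree : homog 0 unit2;
  del_degree : has_degree (-1) del;
  bulA : forall a b c, bul (bul (a \ox b) \ox c) = bul (a \ox bul (b \ox c));
  bul1l : forall a, bul (unit2 \ox a) = a;
  bul1r : forall a, bul (a \ox unit2) = a;
  odotA : forall a b c, odot (odot (a \ox b) \ox c) = odot (a \ox odot (b \ox c));
  odot1l : forall a, odot (unit2 \ox a) = a;
  odot1r : forall a, odot (a \ox unit2) = a;
  del_sq : forall a, del (del a) = 0;
  del_bul : forall t, del (bul t) = bul (leibniz del t)
}.

(* The iterated product on the reduced part; the value 0 on the empty word is
   a junk value. *)
Definition tau1 (V : gradedVectType K) (S : TwoAssDiffAlg V) : Tc V -> V :=
  wlift (fun w =>
    if w is v :: w' then foldl (fun a b => odot S (a \ox b)) v w' else 0).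

Lemma tau1_word (V : gradedVectType K) (S : TwoAssDiffAlg V) v w :
  tau1 S (word (v :: w)) = foldl (fun a b => odot S (a \ox b)) v w.
Proof.
have [tl tr] := tens_bilinear V V.
have lf u : linear (fun a => foldl (fun a b => odot S (a \ox b)) a u).
  elim: u => [|z u IH] a x y //=; by rewrite tl linearP IH.
rewrite /tau1 wlift_word // => -[|z u] u' a x y; first exact: lf.
by rewrite /= !foldl_cat /= tr linearP lf.
Qed.

(* The property that characterizes the underlying B-infinity structure among
   all those on V.  The equality on the tensor square of the reduced part is
   stated on its spanning set of pure tensors. *)
Definition underlying_Binf (V : gradedVectType K) (S : TwoAssDiffAlg V)
    (U : Binf V) : Prop :=
  (forall a b : Tc V, reduced a -> reduced b ->
     tau1 S (bmul U (a \ox b)) = bul S (tau1 S a \ox tau1 S b)) /\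
  (forall a : Tc V, reduced a -> tau1 S (bdiff U a) = del S (tau1 S a)).

Definition Tc_TwoAssDiffAlg (A : gradedVectType K) (B : Binf A) :
    TwoAssDiffAlg (Tc A) :=
  MkTwoAssDiffAlg (odot := @conc K A)
    (bmul_degree B) (@conc_degree K A) (one_homog A) (bdiff_degree B)
    (bmulA B) (bmul1l B) (bmul1r B)
    (@concA K A) (@conc1l K A) (@conc1r K A)
    (bdiff_sq B) (bdiff_bmul B).

End Binfinity.

(* Main.v *)
Require Import Defs.
From HB Require Import structures.
From mathcomp Require Import all_boot all_algebra zify.

Set Implicit Arguments.
Unset Strict Implicit.
Unset Printing Implicit Defensive.

Import GRing.Theory.
Local Open Scope ring_scope.

(** Let [F : Tc A -> Tc (Tc A)] be the coalgebra map that applies [in1] to every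
letter.  Write [d], [m] for the differential and the product on [Tc A], and [D],
[M] for those on [Tc (Tc A)].  Since [proj1 \o F = in1 \o proj1], the map [in1]
commutes with all structure maps as soon as [F] intertwines the two differentials
and the two products: [D (F t) = F (d t)] and [M (F u \ox F v) = F (m (u \ox v))]
([Tcmap_in1_bdiff], [Tcmap_in1_bmul]).

In each equation both sides are maps of the same coalgebraic kind into
[Tc (Tc A)]: coderivations along [F] in the first one, coalgebra maps in the
second one.  If two such maps agree on all shorter words, then in the coproduct
of their difference [h] only the two extreme terms survive, so that [h] is
primitive ([bdiff_defect_primitive], [bmul_defect_primitive]); and the primitive
elements of a tensor coalgebra are its one-letter words ([primitive_in1]).  On
one-letter words [tau1] is the identity, hence a primitive element killed by
[tau1] vanishes ([primitive_tau1_eq0]).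

The iterated product here is concatenation, therefore [tau1 \o F] is the identity
on reduced elements ([tau1_Tcmap_in1]).  With the equations defining the
underlying structure, [tau1] sends [D (F t)] to [d t], and it sends [F (d t)] to
[d t] too; likewise [M (F u \ox F v)] and [F (m (u \ox v))] both go to
[m (u \ox v)].  So [tau1] kills the difference in both cases, and induction on
the number of letters concludes.

The induction runs over words with homogeneous letters: they span, their
prefixes and suffixes are again of this form, and on them every Koszul sign is
explicit. *)

(** * Linear maps on tensor products *)

HB.instance Definition _ (K : fieldType) (U V U' V' : gradedVectType K) k
    (f : {linear U -> U'}) (g : {linear V -> V'}) :=
  GRing.isLinear.Build K (tensor U V) (tensor U' V') *:%R (ktens k f g)
    (tlift_linear (ktens_bilinear k f g)).

HB.instance Definition _ (K : fieldType) (A B C D : gradedVectType K) :=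
  GRing.isLinear.Build K _ _ *:%R (@midswap K A B C D)
    (@midswap_linear K A B C D).

HB.instance Definition _ (K : fieldType) (X : gradedVectType K) :=
  GRing.isLinear.Build K _ _ *:%R (@counit2 K X)
    (tlift_linear (@counit2_bilinear K X)).

Section Tens.
Variables (K : fieldType) (U V : gradedVectType K).

Lemma tensBl (u u' : U) (v : V) : (u - u') \ox v = u \ox v - u' \ox v.
Proof. by rewrite -scaleN1r addrC (tens_bilinear _ _).1 scaleN1r addrC. Qed.

Lemma tensBr (u : U) (v v' : V) : u \ox (v - v') = u \ox v - u \ox v'.
Proof. by rewrite -scaleN1r addrC (tens_bilinear _ _).2 scaleN1r addrC. Qed.

Lemma leibniz_linear (d : {linear V -> V}) : linear (leibniz d).
Proof.
move=> a x y; rewrite /leibniz linearP /= [ktens (-1) _ _ _]linearP /=.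
by rewrite scalerDr addrACA.
Qed.

HB.instance Definition _ (d : {linear V -> V}) :=
  GRing.isLinear.Build K _ _ *:%R (leibniz d) (leibniz_linear d).

Lemma leibniz_tens (d : {linear V -> V}) i u v : homog i u ->
  leibniz d (u \ox v) = d u \ox v + (-1) ^ (-1 * i) *: (u \ox d v).
Proof. by move=> hu; rewrite /leibniz ktens0_tens (ktens_tens _ _ _ _ hu). Qed.

End Tens.

(** * Words with homogeneous letters *)

Section HomogeneousWords.
Variables (K : fieldType) (X : gradedVectType K).
Implicit Types s t : seq (int * X).

(** The degrees are stored next to the letters: the degree of a homogeneous
letter is not a function of the letter, as 0 is homogeneous of every degree. *)
Definition hletters s : bool := all (fun p => gproj p.1 p.2 == p.2) s.

Definition hword s : Tc X := word [seq p.2 | p <- s].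

Definition hdeg s : int := \sum_(p <- s) p.1.

Lemma hword_homog s : hletters s -> homog (hdeg s) (hword s).
Proof. by move=> /allP hs; apply: word_homog => p /hs/eqP. Qed.

Lemma hletters_take i s : hletters s -> hletters (take i s).
Proof. by rewrite -{1}(cat_take_drop i s) /hletters all_cat => /andP[]. Qed.

Lemma hletters_drop i s : hletters s -> hletters (drop i s).
Proof. by rewrite -{1}(cat_take_drop i s) /hletters all_cat => /andP[]. Qed.

(** By multilinearity: the letters of a word are replaced, from left to right, by
their homogeneous components. *)
Lemma Tc_ext_hword (W : lmodType K) (f g : {linear Tc X -> W}) :
  (forall s, hletters s -> f (hword s) = g (hword s)) -> f =1 g.
Proof.
move=> fg; apply: Tc_ext; [exact: linearP | exact: linearP |] => w.
(* [s] is the prefix whose letters have already been made homogeneous. *)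
suff: forall s, hletters s ->
    f (word ([seq p.2 | p <- s] ++ w)) = g (word ([seq p.2 | p <- s] ++ w)).
  by move=> /(_ [::] isT).
elim: w => [|x w IH] s hs; first by rewrite cats0; exact: fg.
pose ins (y : X) := word ([seq p.2 | p <- s] ++ y :: w).
have lins : linear ins by move=> a y z; exact: word_multilin.
pose ins' : {linear X -> Tc X} :=
  HB.pack ins (GRing.isLinear.Build K _ _ *:%R ins lins).
rewrite -[word _]/(ins' x) (gsupp_sum x) !linear_sum /=.
apply: eq_bigr => n _.
have := IH (rcons s (n, gproj n x)).
rewrite map_rcons cat_rcons; apply.
by rewrite /hletters all_rcons /= gproj_proj !eqxx.
Qed.

Lemma tens_ext_hword (W : lmodType K)
    (f g : {linear tensor (Tc X) (Tc X) -> W}) :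
  (forall s t, hletters s -> hletters t ->
     f (hword s \ox hword t) = g (hword s \ox hword t)) -> f =1 g.
Proof.
move=> fg; have [tl tr] := tens_bilinear (Tc X) (Tc X).
apply: tens_ext => [a x y|a x y|u v]; rewrite ?linearP //.
pose ml v : {linear Tc X -> _} := HB.pack (fun u : Tc X => u \ox v)
  (GRing.isLinear.Build K _ _ *:%R _ (tl v)).
pose mr u : {linear Tc X -> _} := HB.pack (fun v : Tc X => u \ox v)
  (GRing.isLinear.Build K _ _ *:%R _ (tr u)).
move: u; apply: (Tc_ext_hword (f := f \o ml v) (g := g \o ml v)) => s hs /=.
move: v; apply: (Tc_ext_hword (f := f \o mr _) (g := g \o mr _)) => t ht /=.
exact: fg.
Qed.

Lemma deconc_hword s : deconc (hword s) =
  \sum_(i < (size s).+1) hword (take i s) \ox hword (drop i s).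
Proof.
rewrite /hword deconc_word size_map.
by apply: eq_bigr => i _; rewrite map_take map_drop.
Qed.

Lemma hword_reduced s : (0 < size s)%N -> reduced (hword s).
Proof. by rewrite /reduced /hword counit_word; case: s. Qed.

End HomogeneousWords.

(** * Primitive elements of the tensor coalgebra *)

Section Primitive.
Variables (K : fieldType) (X : gradedVectType K).

Lemma counit2_deconc (t : Tc X) : counit2 (deconc t) = counit t.
Proof.
move: t; apply: Tc_ext => [a x y|a x y|w]; rewrite ?linearP //.
rewrite deconc_word linear_sum /= counit_word.
case: w => [|x w].
  by rewrite big_ord_recl big_ord0 counit2_tens !counit_word /= mulr1 addr0.
rewrite big1 // => i _; rewrite counit2_tens !counit_word.
case: i => [[|i] hi] /=; first by rewrite mulr0.
by rewrite mul0r.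
Qed.

Definition primitive (h : Tc X) : Prop :=
  deconc h = word [::] \ox h + h \ox word [::].

(** The counit of the coproduct of [h] is [counit h] once and twice. *)
Lemma counit_primitive h : primitive h -> counit h = 0.
Proof.
move=> hp; have := counit2_deconc h.
rewrite hp linearD /= !counit2_tens counit_word mul1r mulr1.
by move=> /(canRL (addrK _)) ->; rewrite subrr.
Qed.

(** Cutting off the first letter and putting it back recovers every nonempty
word; the empty word is lost. *)
Lemma conc_proj1_deconc (t : Tc X) :
  conc (ktens 0 (@in1 K X \o @proj1 K X) idfun (deconc t)) =
    t - (counit t : K) *: (word [::] : Tc X).
Proof.
pose R (t : Tc X) := t - (counit t : K) *: (word [::] : Tc X).
have lR : linear R.
  move=> a x y; rewrite /R linearP /= scalerBr scalerDl opprD addrACA.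
  by rewrite scalerA.
rewrite -/(R t); move: t; apply: Tc_ext => // [a x y|w].
  by rewrite !linearP.
rewrite /R deconc_word counit_word !linear_sum /=.
case: w => [|x w].
  rewrite big_ord1 ktens0_tens /= proj1_word linear0 tens0l linear0.
  by rewrite scale1r subrr.
(* Only the cut after the first letter contributes: [proj1] kills the other
   prefixes. *)
rewrite scale0r subr0 big_ord_recl ktens0_tens /= proj1_word linear0 tens0l.
rewrite linear0 add0r big_ord_recl ktens0_tens /= take0 drop0 proj1_word.
rewrite conc_word big1 ?addr0 // => -[i hi] _.
rewrite ktens0_tens /= proj1_word /bump /= add1n.
by case: w hi => //= y w _; rewrite linear0 tens0l linear0.
Qed.

(** In [1 \ox h + h \ox 1] the map of [conc_proj1_deconc] kills [1 \ox h] and sends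
[h \ox 1] to the one-letter part of [h]. *)
Lemma primitive_in1 h : primitive h -> h = in1 (proj1 h).
Proof.
move=> hp; have := conc_proj1_deconc h.
rewrite (counit_primitive hp) scale0r subr0 hp linearD /= linearD /=.
rewrite !ktens0_tens /= proj1_word linear0 tens0l linear0 add0r.
by rewrite conc1r.
Qed.

End Primitive.

(** * The coalgebra map induced by a linear map *)

Section Tcmap.
Variables (K : fieldType) (X Y : gradedVectType K) (f : {linear X -> Y}).

Definition Tcmap : Tc X -> Tc Y := wlift (fun w => word (map f w)).

Let Tcmap_multilin : multilin (fun w => word (map f w)).
Proof. by move=> u v a x y; rewrite !map_cat /= linearP word_multilin. Qed.

HB.instance Definition _ := GRing.isLinear.Build K (Tc X) (Tc Y) *:%R Tcmap
  (wlift_linear Tcmap_multilin).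

Lemma Tcmap_word w : Tcmap (word w) = word (map f w).
Proof. exact: wlift_word. Qed.

Lemma deconc_Tcmap t : deconc (Tcmap t) = ktens 0 Tcmap Tcmap (deconc t).
Proof.
move: t; apply: Tc_ext => [a x y|a x y|w]; rewrite ?linearP //.
rewrite Tcmap_word !deconc_word size_map linear_sum /=.
by apply: eq_bigr => i _; rewrite ktens0_tens /= !Tcmap_word map_take map_drop.
Qed.

Lemma counit_Tcmap t : counit (Tcmap t) = counit t.
Proof.
move: t; apply: Tc_ext => [a x y|a x y|w]; rewrite ?linearP //.
by rewrite Tcmap_word !counit_word; case: w.
Qed.

Lemma proj1_Tcmap t : proj1 (Tcmap t) = f (proj1 t).
Proof.
move: t; apply: Tc_ext => [a x y|a x y|w]; rewrite ?linearP //.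
by rewrite Tcmap_word !proj1_word; case: w => [|x [|y w]] /=; rewrite ?linear0.
Qed.

Definition hmap (s : seq (int * X)) : seq (int * Y) := [seq (p.1, f p.2) | p <- s].

Lemma Tcmap_hword s : Tcmap (hword s) = hword (hmap s).
Proof. by rewrite /hword Tcmap_word -!map_comp. Qed.

Lemma hdeg_hmap s : hdeg (hmap s) = hdeg s.
Proof. by rewrite /hdeg big_map. Qed.

Lemma hletters_hmap s : has_degree 0 f -> hletters s -> hletters (hmap s).
Proof.
move=> hf; rewrite /hletters all_map; apply: sub_all => -[n x] /= /eqP hx.
by apply/eqP; have := hf n x hx; rewrite addr0.
Qed.

End Tcmap.

(** * Sums concentrated on the extreme indices *)

Section EndSums.
Variable V : zmodType.

Lemma sum_ends n (E : 'I_n.+1 -> V) : (0 < n)%N ->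
  (forall i : 'I_n.+1, (0 < i < n)%N -> E i = 0) ->
  \sum_i E i = E ord0 + E ord_max.
Proof.
move=> n0 E0; rewrite (bigD1 ord0) //= (bigD1 ord_max) /=; last first.
  by rewrite -val_eqE /= -lt0n.
rewrite big1 ?addr0 // => i /andP[]; rewrite -!val_eqE /= => i0 iN.
by apply: E0; rewrite lt0n i0 ltn_neqAle iN -ltnS ltn_ord.
Qed.

Lemma sum_corners m n (E : 'I_m.+1 -> 'I_n.+1 -> V) : (0 < m)%N ->
  (forall (i : 'I_m.+1) (j : 'I_n.+1), (0 < i + j < m + n)%N -> E i j = 0) ->
  \sum_i \sum_j E i j = E ord0 ord0 + E ord_max ord_max.
Proof.
move=> m0 E0; rewrite pair_bigA (bigD1 (ord0, ord0)) //=.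
rewrite (bigD1 (ord_max, ord_max)) /=; last first.
  by rewrite xpair_eqE -val_eqE /= negb_and -lt0n m0.
rewrite big1 ?addr0 // => -[i j]; rewrite !xpair_eqE -!val_eqE /= => /andP[h0 hN].
have him : (i <= m)%N by rewrite -ltnS.
have hjn : (j <= n)%N by rewrite -ltnS.
by apply: E0; lia.
Qed.

End EndSums.

(** * The structure maps and deconcatenation *)

Section Structure.
Variables (K : fieldType) (X : gradedVectType K) (B : Binf X).
Implicit Types s t : seq (int * X).

Lemma deconc_bdiff_hword s : hletters s ->
  deconc (bdiff B (hword s)) = \sum_(i < (size s).+1)
    (bdiff B (hword (take i s)) \ox hword (drop i s) +
     (-1) ^ (-1 * hdeg (take i s)) *:
        (hword (take i s) \ox bdiff B (hword (drop i s)))).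
Proof.
move=> hs; rewrite bdiff_deconc deconc_hword linear_sum; apply: eq_bigr => i _.
exact/leibniz_tens/hword_homog/hletters_take.
Qed.

(** In [deconc (d w)] only the terms [d w \ox 1] and [1 \ox d w] are seen by the
counit, whence [counit (d w) = counit (d w) + counit (d w)]. *)
Lemma counit_bdiff x : counit (bdiff B x) = 0.
Proof.
pose Z : {linear Tc X -> K^o} := \0.
rewrite -[RHS]/(Z x) -[LHS]/((@counit K X \o bdiff B : {linear Tc X -> K^o}) x).
move: x; apply: Tc_ext_hword => s hs /=.
have [->|s0] := eqVneq s [::]; first by rewrite bdiff1 linear0.
rewrite -size_eq0 -lt0n in s0.
have := counit2_deconc (bdiff B (hword s)).
rewrite deconc_bdiff_hword // linear_sum /=.
have ew : forall r : seq (int * X), (0 < size r)%N -> counit (hword r) = 0.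
  exact: hword_reduced.
rewrite sum_ends // => [|i /andP[i0 iN]] /=;
  rewrite !linearD !linearZ /= !counit2_tens.
  rewrite take0 drop0 take_size drop_size ew // bdiff1 linear0 counit_word /=.
  rewrite /hdeg big_nil !(mulr0, mul0r) ?scaler0 expr0z scale1r addr0 add0r mul1r mulr1.
  by move=> /(canRL (addrK _)) ->; rewrite subrr.
rewrite !ew ?size_drop ?subn_gt0 ?size_takel // ?(ltnW iN) //.
by rewrite !(mulr0, mul0r) ?scaler0 addr0.
Qed.

Lemma deconc_bmul_hword s t : hletters s -> hletters t ->
  deconc (bmul B (hword s \ox hword t)) =
  \sum_(i < (size s).+1) \sum_(j < (size t).+1)
    (-1) ^ (hdeg (drop i s) * hdeg (take j t)) *:
      (bmul B (hword (take i s) \ox hword (take j t)) \ox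
       bmul B (hword (drop i s) \ox hword (drop j t))).
Proof.
move=> hs ht; rewrite bmul_deconc /deconc2 ktens0_tens /= !deconc_hword.
rewrite tens_suml !linear_sum; apply: eq_bigr => i _ /=.
rewrite tens_sumr !linear_sum; apply: eq_bigr => j _ /=.
rewrite (midswap_tens _ _ (hword_homog (hletters_drop i hs))
  (hword_homog (hletters_take j ht))).
by rewrite linearZ /= ktens0_tens.
Qed.

End Structure.

(** * The defects of commutation are primitive *)

Section Defect.
Variables (K : fieldType) (X Y : gradedVectType K) (B : Binf X) (C : Binf Y).
Variables (f : {linear X -> Y}) (hf : has_degree 0 f).
Implicit Types s t : seq (int * X).
Local Notation F := (Tcmap f).

(** Both maps are coderivations along [F], so the term of the coproduct of the
difference at a cut of the word involves the defects of the two pieces.  These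
vanish when both pieces are proper, and the defect of the empty word is 0. *)
Lemma bdiff_defect_primitive s : hletters s -> (0 < size s)%N ->
  (forall s', hletters s' -> (size s' < size s)%N ->
     bdiff C (F (hword s')) = F (bdiff B (hword s'))) ->
  primitive (bdiff C (F (hword s)) - F (bdiff B (hword s))).
Proof.
move=> hs s0 IH; rewrite /primitive linearB /=.
rewrite deconc_Tcmap deconc_bdiff_hword // [ktens _ _ _ _]linear_sum /=.
rewrite Tcmap_hword deconc_bdiff_hword ?hletters_hmap // size_map -sumrB.
under eq_bigr => i _.
  rewrite -map_take -map_drop -/(hmap f _) -/(hmap f _) hdeg_hmap -!Tcmap_hword.
  rewrite linearD linearZ /= !ktens0_tens opprD addrACA -tensBl -scalerBr -tensBr.
  over.
rewrite sum_ends //= => [|i /andP[i0 iN]].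
  rewrite take0 drop0 take_size drop_size.
  rewrite -[hword [::]]/(word [::]) /hdeg big_nil mulr0 expr0z scale1r.
  rewrite (Tcmap_word f [::]) !bdiff1 linear0 !subrr tens0l tens0r scaler0 addr0 add0r.
  by rewrite -Tcmap_hword.
rewrite !IH ?hletters_take ?hletters_drop //.
- by rewrite !subrr tens0l tens0r scaler0 addr0.
- by rewrite size_drop ltn_subrL i0.
- by rewrite size_takel // ltnW.
Qed.

(** Both maps are coalgebra maps, so the coproduct is a sum over the cuts of both
words.  The two maps agree on both factors of each term, except for the cuts
that leave the pair of words whole on one side, with a pair of empty words and
the sign 1 on the other side. *)
Lemma bmul_defect_primitive s t : hletters s -> hletters t -> (0 < size s)%N ->
  (forall s' t', hletters s' -> hletters t' ->
     (size s' + size t' < size s + size t)%N ->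
     bmul C (F (hword s') \ox F (hword t')) = F (bmul B (hword s' \ox hword t'))) ->
  primitive (bmul C (F (hword s) \ox F (hword t)) - F (bmul B (hword s \ox hword t))).
Proof.
move=> hs ht s0 IH; rewrite /primitive linearB /=.
rewrite deconc_Tcmap deconc_bmul_hword // [ktens _ _ _ _]linear_sum /=.
rewrite !Tcmap_hword deconc_bmul_hword ?hletters_hmap // !size_map -sumrB.
under eq_bigr => i _.
  rewrite [ktens _ _ _ _]linear_sum /= -sumrB.
  under eq_bigr => j _.
    rewrite -!map_take -!map_drop -!/(hmap f _) !hdeg_hmap -!Tcmap_hword.
    rewrite linearZ /= !ktens0_tens -scalerBr.
    over.
  over.
rewrite sum_corners //= => [|i j /andP[ij0 ijN]].
  rewrite !take0 !drop0 !take_size !drop_size.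
  rewrite -![hword [::]]/(word [::]) /hdeg !big_nil !(mulr0, mul0r) expr0z !scale1r.
  rewrite !(Tcmap_word f [::]) !bmul1l !(Tcmap_word f [::]).
  by rewrite -tensBr -tensBl -!Tcmap_hword.
rewrite !IH ?hletters_take ?hletters_drop ?subrr ?scaler0 //.
- rewrite !size_drop.
  have him : (i <= size s)%N by rewrite -ltnS.
  have hjn : (j <= size t)%N by rewrite -ltnS.
  by lia.
- by rewrite !size_takel // -ltnS.
Qed.

End Defect.

(** * The inclusion of the generators *)

Section Underlying.
Variables (K : fieldType) (A : gradedVectType K) (B : Binf A).
Local Notation TA := (Tc_TwoAssDiffAlg B).
Local Notation F := (Tcmap (@in1 K A)).

Let tau1_multilin : multilin (fun w : seq (Tc A) =>
  if w is v :: w' then foldl (fun a b => odot TA (a \ox b)) v w' else 0).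
Proof.
have [tl tr] := tens_bilinear (Tc A) (Tc A).
have foldl_lin u : linear (fun a => foldl (fun a b => odot TA (a \ox b)) a u).
  by elim: u => [|z u IH] a x y //=; rewrite tl linearP IH.
move=> [|v u] w a x y; first exact: foldl_lin.
by rewrite /= !foldl_cat /= tr linearP foldl_lin.
Qed.

HB.instance Definition _ :=
  GRing.isLinear.Build K _ _ *:%R (tau1 TA) (wlift_linear tau1_multilin).

Lemma tau1_Tcmap_in1 t : reduced t -> tau1 TA (F t) = t.
Proof.
(* [tau1] is 0 on the empty word, hence on all of [Tc A] the composite is the
   projection [R] onto the reduced part. *)
pose R (t : Tc A) := t - (counit t : K) *: (word [::] : Tc A).
have lR : linear R.
  move=> a x y; rewrite /R linearP /= scalerBr scalerDl opprD addrACA.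
  by rewrite scalerA.
move=> ht; transitivity (R t); last by rewrite /R ht scale0r subr0.
move: t {ht}; apply: Tc_ext => // [a x y|w]; first by rewrite !linearP.
rewrite Tcmap_word /R counit_word; case: w => [|x w].
  by rewrite scale1r subrr /tau1 wlift_word.
rewrite scale0r subr0 tau1_word /= /in1 -[x :: w]/([:: x] ++ w).
elim: w [:: x] => [|y w IH] u /=; first by rewrite cats0.
by rewrite conc_word IH -catA.
Qed.

Lemma primitive_tau1_eq0 h : primitive h -> tau1 TA h = 0 -> h = 0.
Proof.
move=> /primitive_in1 e; rewrite e /in1 tau1_word /= => ->.
exact: (linear0 (@in1 K (Tc A))).
Qed.

Variables (U : Binf (Tc A)) (hU : underlying_Binf TA U).

(** On a nonempty word [w], [tau1] maps both sides to [bdiff B w], by the equation characterizing the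
differential of [U]; hence the primitive defect vanishes. *)
Lemma Tcmap_in1_bdiff t : bdiff U (F t) = F (bdiff B t).
Proof.
rewrite -[LHS]/((bdiff U \o F : {linear Tc A -> _}) t).
rewrite -[RHS]/((F \o bdiff B : {linear Tc A -> _}) t).
move: t; apply: Tc_ext_hword => s /=.
have [n] := ubnP (size s); elim: n s => // n IH s sn hs.
have [s0|s0] := posnP (size s).
  by rewrite (size0nil s0) (Tcmap_word _ [::]) !bdiff1 linear0.
apply: subr0_eq; apply: primitive_tau1_eq0.
  apply: bdiff_defect_primitive => // [|s' hs' lt].
    exact: in1_degree.
  by apply: IH => //; apply: leq_trans lt _.
rewrite linearB /= hU.2 ?/reduced ?counit_Tcmap ?hword_reduced //.
rewrite !tau1_Tcmap_in1; [exact: subrr | exact: hword_reduced |].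
exact: counit_bdiff.
Qed.

(** Pairs with an empty word are settled by the unit laws, which is needed because
the equation characterizing the product of [U] concerns reduced elements only. *)
Lemma Tcmap_in1_bmul t : bmul U (ktens 0 F F t) = F (bmul B t).
Proof.
rewrite -[LHS]/((bmul U \o ktens 0 F F : {linear tensor _ _ -> _}) t).
rewrite -[RHS]/((F \o bmul B : {linear tensor _ _ -> _}) t).
move: t; apply: tens_ext_hword => s r /=; rewrite ktens0_tens /=.
have [n] := ubnP (size s + size r); elim: n s r => // n IH s r sn hs hr.
have [s0|s0] := posnP (size s).
  by rewrite (size0nil s0) (Tcmap_word _ [::]) !bmul1l.
have [r0|r0] := posnP (size r).
  by rewrite (size0nil r0) (Tcmap_word _ [::]) !bmul1r.
apply: subr0_eq; apply: primitive_tau1_eq0.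
  apply: bmul_defect_primitive => // [|s' r' hs' hr' lt].
    exact: in1_degree.
  by apply: IH => //; apply: leq_trans lt _.
rewrite linearB /= hU.1 ?/reduced ?counit_Tcmap ?hword_reduced //.
rewrite !tau1_Tcmap_in1; [exact: subrr | exact: hword_reduced | exact: hword_reduced |].
by rewrite /reduced bmul_counit counit2_tens hword_reduced ?mul0r.
Qed.

End Underlying.

Theorem theorem3p1p3 (K : fieldType) (A : gradedVectType K) (B : Binf A)
    (U : Binf (Tc A)) (hU : underlying_Binf (Tc_TwoAssDiffAlg B) U) :
  Binf_hom B U (@in1 K A).
Proof.
split=> [|n x _|i j x y _ _]; first exact: in1_degree.
  by rewrite /bm -proj1_Tcmap -(Tcmap_in1_bdiff hU) Tcmap_word.
by rewrite /bm2 -proj1_Tcmap -(Tcmap_in1_bmul hU) ktens0_tens /= !Tcmap_word.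
Qed.
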